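(* Let $u,v\in\mathbb{R}^2$ be linearly independent unit vectors with angle in $(0,\pi)$ between them, let $c_u\neq0$, $c_v>0$ be real constants, and let $T_w$ be the weighted V-line transform with weights $c_u,c_v$. Let $f\in L^1(\mathbb{R}^2)$ be continuous and let $T_wf=0$ on some $S\subset\mathbb{R}^2$. Let $L$ be a line parallel to the vector $$\widetilde\alpha=\frac{c_uv+c_vu}{\|c_uv+c_vu\|}$$ such that $L\cap S\neq\varnothing$. Then $f$ is constant on each connected component of $L\cap S$. In particular, if $S$ is a compact set, $T_wf=0$ in $S$, and $f=0$ on the boundary $\partial S$ of $S$, then $f\equiv0$ in $S$.
   Context: For $(x,y)\in\mathbb{R}^2$ and a unit vector $w$, $R_w(x,y)=\{(x,y)+tw:t\ge0\}$. The weighted V-line transform is $(T_wf)(x,y)=c_v\int_{R_v(x,y)}f\,dl+c_u\int_{R_u(x,y)}f\,dl$, where $dl$ is the one-dimensional Lebesgue measure.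
   Formalization: In the first assertion S is assumed open; for arbitrary S it is false: with u=e1, v=e2, c_u=c_v=1, f=g(min(x,y))k(|x-y|), k(0)=1, ∫k=0, g nonconstant (both in C_c), T_wf=0 on the diagonal but f is not constant there. *)

(* Defs.v *)
From HB Require Import structures.
From mathcomp Require Import all_boot all_order all_algebra.
From mathcomp Require Import all_classical all_reals all_analysis.

Set Implicit Arguments.
Unset Strict Implicit.
Unset Printing Implicit Defensive.

Import Order.TTheory GRing.Theory Num.Theory.
Import numFieldNormedType.Exports.

Local Open Scope classical_set_scope.
Local Open Scope ring_scope.

(* The plane is R * R.  The library norm on R * R is the max norm, so the
   Euclidean structure is defined here; the product topology is the usual
   topology of the plane. *)

Definition dot (R : realType) (x y : R * R) : R := x.1 * y.1 + x.2 * y.2.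

Definition enorm (R : realType) (x : R * R) : R := Num.sqrt (dot x x).

Definition angle (R : realType) (x y : R * R) : R :=
  acos (dot x y / (enorm x * enorm y)).

Definition lin_indep (R : realType) (x y : R * R) : Prop :=
  forall a b : R, a *: x + b *: y = 0 -> a = 0 /\ b = 0.

Definition L1_plane (R : realType) (f : R * R -> R) : Prop :=
  ((@lebesgue_measure R) \x (@lebesgue_measure R))%E.-integrable
    [set: R * R] (EFin \o f).

(* For a unit vector w, t |-> x + t w is the arc-length parametrization of the
   ray R_w(x), so this is the integral of f over R_w(x) with respect to dl. *)
Definition ray_integral (R : realType) (f : R * R -> R) (w x : R * R) : \bar R :=
  (\int[@lebesgue_measure R]_(t in `[0%R, +oo[) (f (x + t *: w))%:E)%E.

(* An integrable f need not be integrable along every ray, so the transform is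
   extended-real valued.  The integral of a measurable function that is not
   integrable is +oo or -oo (with oo - oo = -oo), and the sum below is finite
   only if both summands are; hence, for continuous f and nonzero weights,
   vline_transform cu cv u v f x = 0 entails that f is Lebesgue integrable on both rays
   from x. *)
Definition vline_transform (R : realType) (cu cv : R) (u v : R * R)
    (f : R * R -> R) (x : R * R) : \bar R :=
  (cv%:E * ray_integral f v x + cu%:E * ray_integral f u x)%E.

Definition alpha (R : realType) (cu cv : R) (u v : R * R) : R * R :=
  (enorm (cu *: v + cv *: u))^-1 *: (cu *: v + cv *: u).

Definition line_parallel_to (R : realType) (w : R * R) (L : set (R * R)) : Prop :=
  exists p : R * R, L = [set p + t *: w | t in [set: R]].

Definition boundary (T : topologicalType) (S : set T) : set T :=
  closure S `\` interior S.

Definition constant_on (T U : Type) (f : T -> U) (A : set T) : Prop :=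
  exists c : U, forall x, A x -> f x = c.

(* Main.v *)
Require Import Defs.
From HB Require Import structures.
From mathcomp Require Import all_boot all_order all_algebra.
From mathcomp Require Import all_classical all_reals all_analysis.
From mathcomp Require Import measurable_realfun.

Set Implicit Arguments.
Unset Strict Implicit.
Unset Printing Implicit Defensive.

Import Order.TTheory GRing.Theory Num.Theory.
Import numFieldNormedType.Exports.

Local Open Scope classical_set_scope.
Local Open Scope ring_scope.

(** Write X_w f (x) for the integral of f over the ray from x in direction w.
By the fundamental theorem of calculus its derivative in the direction w is
- f (is_derive_ray_integral).  Where the transform vanishes, both ray integrals
are finite and F := cv X_v f = - cu X_u f (vline_transform_eq0); the two
expressions of F give, on an open set where the transform vanishes,
  D_v F = - cv f   and   D_u F = cu f.
These partial derivatives are continuous, so F can be differentiated along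
combinations of u and v (is_derive_lin_comb), and in the direction
w = cu v + cv u of the line its derivative is cu (- cv f) + cv (cu f) = 0.
Hence F is locally constant along w, and so is every derivative of F in a fixed
direction, in particular cu f (locally_constant_along).  As f is a priori only
continuous, the argument never differentiates f.

It remains to pass from local to global.  A connected subset of the line on
which f is locally constant has f constant (connected_constant_on).  On a
compact S, if f vanishes on the boundary but f x <> 0, then the points of the
line through x that lie in S and have the same value of f as x form a closed
set; they lie in the interior of S, where f is locally constant along the line,
so this set is also open in the line, hence is the whole line, which is not
bounded (vline_zero_compact). *)

(** * Directional derivatives *)

Lemma is_derive_cvgP (R : realType) (V : normedModType R) (F : V -> R) x v l :
  is_derive x v F l <-> h^-1 *: (F (h *: v + x) - F x) @[h --> 0^'] --> l.
Proof.
split=> [[dF <-] //|Fl]; apply: DeriveDef; first by apply/cvg_ex; exists l.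
exact: cvg_lim Fl.
Qed.

Lemma is_derive_line (R : realType) (V : normedModType R) (F : V -> R)
    y w t l : is_derive (y + t *: w) w F l ->
  is_derive t 1 (fun s => F (y + s *: w)) l.
Proof.
move=> /is_derive_cvgP Fl; apply/is_derive_cvgP.
suff -> : (fun h => h^-1 *: (F (y + (h *: 1 + t) *: w) - F (y + t *: w))) =
  (fun h => h^-1 *: (F (h *: w + (y + t *: w)) - F (y + t *: w))) by [].
apply/funext => h; congr (_ *: (F _ - _)).
by rewrite [h *: 1]mulr1 scalerDl addrCA.
Qed.

(** The point s runs over [0, 1] and the step r carries the sign, so that no
case distinction on the sign of r is needed in the applications. *)
Lemma MVT_line (R : realType) (V : normedModType R) (F g : V -> R) y w (r : R) :
  (forall s : R, 0 <= s <= 1 ->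
     is_derive (y + (r * s) *: w) w F (g (y + (r * s) *: w))) ->
  exists2 s : R, 0 <= s <= 1 & F (y + r *: w) - F y = r * g (y + (r * s) *: w).
Proof.
move=> dF.
have dq (s : R) : 0 <= s <= 1 -> is_derive s 1 (fun s => F (y + (r * s) *: w))
    (r * g (y + (r * s) *: w)).
  move=> /dF/is_derive_line dFs; rewrite mulrC.
  apply: (@is_derive1_comp _ (fun s => F (y + s *: w)) ( *%R r)) => //.
  by apply: is_derive_eq; rewrite [_ *: _]mulr1.
have [||s s01] := @MVT_segment R (fun s => F (y + (r * s) *: w))
  (fun s => r * g (y + (r * s) *: w)) 0 1 ler01.
- by move=> s; rewrite in_itv/= => /andP[s0 s1]; apply: dq; rewrite !ltW.
- apply: derivable_within_continuous => s; rewrite in_itv/= => /dq[+ _].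
  exact.
- by rewrite mulr1 mulr0 scale0r addr0 subr0 mulr1 => ?; exists s.
Qed.

(** The increment of F along h (p u + q v) is split at x + h p u; the mean value
theorem turns the two parts into h p gu and h q gv at points close to x, and
continuity of gu and gv at x gives the limit.  This is the usual proof that
continuous partial derivatives imply differentiability. *)
Lemma is_derive_lin_comb (R : realType) (V : normedModType R)
    (F gu gv : V -> R) x u v p q :
  (\forall y \near x, is_derive y u F (gu y)) ->
  (\forall y \near x, is_derive y v F (gv y)) ->
  {for x, continuous gu} -> {for x, continuous gv} ->
  is_derive x (p *: u + q *: v) F (p * gu x + q * gv x).
Proof.
move=> dFu dFv cgu cgv; apply/is_derive_cvgP/cvgrPdist_le => /= e e0.
(* The summand 1 keeps M and N positive when p = q = 0 or u = v = 0. *)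
pose M : R := `|p| + `|q| + 1; pose N : R := `|p| * `|u| + `|q| * `|v| + 1.
have M0 : 0 < M by rewrite ltr_wpDl ?addr_ge0.
have N0 : 0 < N by rewrite ltr_wpDl ?addr_ge0 ?mulr_ge0.
have eM0 : 0 < e / M by rewrite divr_gt0.
have /nbhs_ballP[d /= d0 Bd] : \forall y \near x,
    [/\ is_derive y u F (gu y), is_derive y v F (gv y),
      `|gu x - gu y| <= e / M & `|gv x - gv y| <= e / M].
  near=> y; split.
  - near: y; exact: dFu.
  - near: y; exact: dFv.
  - near: y; by move/cvgrPdist_le : cgu; apply.
  - near: y; by move/cvgrPdist_le : cgv; apply.
near=> h.
have small (s t : R) : 0 <= s <= 1 -> 0 <= t <= 1 ->
    ball x d (x + (h * p * s) *: u + (h * q * t) *: v).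
  move=> /andP[s0 s1] /andP[t0 t1].
  rewrite -ball_normE/= -addrA opprD addNKr normrN.
  rewrite (le_lt_trans (ler_normD _ _))// !normrZ ?normrM.
  rewrite (ger0_norm s0) (ger0_norm t0).
  apply: (@le_lt_trans _ _ (`|h| * N)).
    rewrite /N !mulrDr mulr1 -[leLHS]addr0 lerD// lerD// -!mulrA.
      by rewrite !ler_wpM2l// ler_piMl.
    by rewrite !ler_wpM2l// ler_piMl.
  by rewrite -ltr_pdivlMr//; near: h; apply: dnbhs0_lt; rewrite divr_gt0.
have zero01 : (0 <= 0 :> R) && (0 <= 1 :> R) by rewrite lexx ler01.
have one01 : (0 <= 1 :> R) && (1 <= 1 :> R) by rewrite ler01 lexx.
have [s s01 Fu] : exists2 s : R, 0 <= s <= 1 &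
    F (x + (h * p) *: u) - F x = h * p * gu (x + (h * p * s) *: u).
  apply: MVT_line => s s01.
  by have := small _ _ s01 zero01; rewrite mulr0 scale0r addr0 => /Bd[].
have [t t01 Fv] : exists2 t : R, 0 <= t <= 1 &
    F (x + (h * p) *: u + (h * q) *: v) - F (x + (h * p) *: u) =
    h * q * gv (x + (h * p) *: u + (h * q * t) *: v).
  apply: MVT_line => t t01.
  by have := small _ _ one01 t01; rewrite mulr1 => /Bd[].
have /Bd[_ _ gus _] := small _ _ s01 zero01.
rewrite mulr0 scale0r addr0 in gus.
have /Bd[_ _ _ gvt] := small _ _ one01 t01.
rewrite mulr1 in gvt.
have h0 : h != 0 by near: h; exact: nbhs_dnbhs_neq.
have -> : F (h *: (p *: u + q *: v) + x) - F x =
    h * (q * gv (x + (h * p) *: u + (h * q * t) *: v) +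
         p * gu (x + (h * p * s) *: u)).
  rewrite mulrDr !mulrA -Fv -Fu addrA subrK; congr (F _ - _).
  by rewrite addrC scalerDr !scalerA addrA.
rewrite [_ *: _]mulrA mulVf// mul1r [in X in `|_ - X|]addrC opprD addrACA.
rewrite -!mulrBr (le_trans (ler_normD _ _))// !normrM.
apply: (@le_trans _ _ (`|p| * (e / M) + `|q| * (e / M))).
  by rewrite lerD// ler_wpM2l.
rewrite -mulrDl mulrCA ger_pMr// ler_pdivrMr// mul1r.
by rewrite /M lerDl.
Unshelve. all: by end_near. Qed.

(** * Integrals over half-lines *)

(** In the extended reals a difference is finite only if both terms are, so the
integrals of the positive and of the negative part are both finite. *)
Lemma fin_num_integrable d (T : measurableType d) (R : realType)
    (mu : {measure set T -> \bar R}) (D : set T) (f : T -> \bar R) :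
  measurable D -> measurable_fun D f ->
  (\int[mu]_(x in D) f x)%E \is a fin_num -> mu.-integrable D f.
Proof.
move=> mD mf; rewrite integralE fin_numB => /andP[fp fn].
apply/integrableP; split => //.
rewrite -[fun x => _]/(abse \o f) fune_abse ge0_integralD//.
- by rewrite lte_add_pinfty// ltey_eq ?fp ?fn.
- exact: measurable_funepos.
- exact: measurable_funeneg.
Qed.

Lemma integrable_disjointU d (T : measurableType d) (R : realType)
    (mu : {measure set T -> \bar R}) (A B : set T) (f : T -> \bar R) :
  measurable A -> measurable B -> [disjoint A & B] ->
  mu.-integrable A f -> mu.-integrable B f -> mu.-integrable (A `|` B) f.
Proof.
move=> mA mB AB /integrableP[mfA fA] /integrableP[mfB fB].
have mfAB : measurable_fun (A `|` B) f by exact/measurable_funU.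
apply/integrableP; split => //.
rewrite ge0_integral_setU//; first exact: lte_add_pinfty.
exact: measurableT_comp.
Qed.

(** Change of variable for the increasing function t + r; the sign condition
makes it valid whether or not k is integrable. *)
Lemma ge0_integral_tail_shift (R : realType) (k : R -> R) (r : R) :
  continuous k -> (forall t, 0 <= k t) ->
  (\int[@lebesgue_measure R]_(t in `[0%R, +oo[) (k (t + r))%:E =
   \int[@lebesgue_measure R]_(t in `[r, +oo[) (k t)%:E)%E.
Proof.
move=> ck k0.
have d1 : derive1 (shift r : R -> R) = cst 1.
  apply/funext => x; rewrite derive1E.
  exact: (congr1 (@^~ x) (derive_shift 1 r)).
have r0 : r = shift r 0 by rewrite /= add0r.
rewrite [in RHS]r0.
rewrite (@increasing_ge0_integration_by_substitutiony R (shift r) k 0).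
- by apply: eq_integral => t _; rewrite d1 /= mulr1.
- by move=> x y _ _ xy; rewrite /= ltrD2r.
- by move=> x _; rewrite d1; exact: cvg_cst.
- by rewrite d1; exact: is_cvg_cst.
- by rewrite d1; exact: is_cvg_cst.
- split=> [x _|]; first exact: ex_derive.
  apply: cvg_at_right_filter; apply: cvgD; [exact: cvg_id|exact: cvg_cst].
- exact: cvg_addrr.
- exact: continuous_subspaceT.
- by move=> *; exact: k0.
Qed.

Lemma integral_tail_shift (R : realType) (k : R -> R) (r : R) : continuous k ->
  (\int[@lebesgue_measure R]_(t in `[0%R, +oo[) (k (t + r))%:E =
   \int[@lebesgue_measure R]_(t in `[r, +oo[) (k t)%:E)%E.
Proof.
move=> ck; rewrite integralE [RHS]integralE.
have cp : continuous k^\+.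
  move=> t; apply: (@continuous_max R R k (cst 0) t); first exact: ck.
  exact: cst_continuous.
have cn : continuous k^\-.
  move=> t; apply: (@continuous_max R R (\- k) (cst 0) t).
    exact/continuousN/ck.
  exact: cst_continuous.
have pos (h : R -> R) D :
    (\int[@lebesgue_measure R]_(t in D) ((EFin \o h)^\+ t) =
     \int[@lebesgue_measure R]_(t in D) (h^\+ t)%:E)%E by rewrite funerpos.
have neg (h : R -> R) D :
    (\int[@lebesgue_measure R]_(t in D) ((EFin \o h)^\- t) =
     \int[@lebesgue_measure R]_(t in D) (h^\- t)%:E)%E by rewrite funerneg.
rewrite (pos (fun t => k (t + r)) _) (pos k _).
rewrite (neg (fun t => k (t + r)) _) (neg k _).
rewrite -(ge0_integral_tail_shift _ cp); last exact: funrpos_ge0.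
by rewrite -(ge0_integral_tail_shift _ cn)//; exact: funrneg_ge0.
Qed.

(** Near r the tail from s equals the constant integral from a := r - 1 minus
the integral over [a, s], whose derivative is given by the fundamental theorem
of calculus. *)
Lemma is_derive_tail_integral (R : realType) (k : R -> R) (r : R) :
  continuous k ->
  (@lebesgue_measure R).-integrable `[r, +oo[ (EFin \o k) ->
  is_derive r 1 (fun s : R => \int[@lebesgue_measure R]_(t in `[s, +oo[) k t)%R
    (- k r).
Proof.
move=> ck kr; pose a := r - 1.
have ar : a < r by rewrite /a ltrBlDr ltrDl.
have ka : (@lebesgue_measure R).-integrable `[a, +oo[ (EFin \o k).
  (* The piece [a, r[ is bounded, so continuity makes k integrable on it. *)
  rewrite (@itv_bndbnd_setU _ _ _ (BLeft r)) ?bnd_simp ?(ltW ar)//.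
  apply: integrable_disjointU => //.
    apply/disj_setPS => t [/=]; rewrite !in_itv/= andbT => /andP[_ tr] rt.
    by move: (lt_le_trans tr rt); rewrite ltxx.
  apply: (@integrableS _ _ _ lebesgue_measure `[a, r]) => //.
    by apply: subset_itvl; rewrite bnd_simp.
  apply: continuous_compact_integrable; first exact: segment_compact.
  exact: continuous_subspaceT.
pose G (s : R) := (\int[@lebesgue_measure R]_(t in `[a, s]) k t)%R.
apply: (@near_eq_is_derive _ _ _
    (fun s => (\int[@lebesgue_measure R]_(t in `[a, +oo[) k t)%R - G s)).
  near=> s.
  have as_ : a < s by near: s; exact: lt_nbhsr.
  rewrite /G Rintegral_itvB ?bnd_simp ?(ltW as_)// Rintegral_itv_obnd_cbnd//.
  apply: (integrableS _ _ _ ka) => //.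
  by apply: subset_itvr; rewrite bnd_simp (ltW as_).
have rr1 : r < r + 1 by rewrite ltrDl.
have kar : (@lebesgue_measure R).-integrable `[a, r + 1] (EFin \o k).
  by apply: (integrableS _ _ _ ka) => //; exact: subset_itvl.
have [dG G'] := continuous_FTC1_closed rr1 kar ar (ck r).
have dGr : is_derive r 1 G (k r).
  by apply: DeriveDef => //; rewrite -derive1E.
have dc := is_derive_cst
  (\int[@lebesgue_measure R]_(t in `[a, +oo[) k t)%R r (1 : R).
by have := is_deriveB dc dGr; rewrite sub0r.
Unshelve. all: by end_near. Qed.

(** Moving the base point by h w cuts the ray integral down to the tail from h
of one and the same function k on the line, so this is a derivative of a tail
integral. *)
Lemma is_derive_ray_integral (R : realType) (f : R * R -> R) (w x : R * R) :
  continuous f ->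
  ray_integral f w x \is a fin_num ->
  is_derive x w (fun y => fine (ray_integral f w y)) (- f x).
Proof.
move=> cf fin; pose k (t : R) := f (x + t *: w).
have ck : continuous k.
  move=> t; apply: continuous_comp; last exact: cf.
  by apply: cvgD; [exact: cvg_cst|apply: cvgZr_tmp; exact: cvg_id].
have k0 : (@lebesgue_measure R).-integrable `[0%R, +oo[ (EFin \o k).
  apply: fin_num_integrable => //; apply/measurable_EFinP.
  by apply: measurable_funTS; exact: continuous_measurable_fun.
have rayE (h : R) :
    fine (ray_integral f w (h *: w + x)) =
    (\int[@lebesgue_measure R]_(t in `[h, +oo[) k t)%R.
  rewrite /Rintegral -(integral_tail_shift _ ck); congr fine.
  apply: eq_integral => t _; congr (f _)%:E.
  by rewrite scalerDl [t *: w + _]addrC addrA [x + _]addrC.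
have /is_derive_cvgP := is_derive_tail_integral ck k0.
rewrite /k scale0r addr0 => dk; apply/is_derive_cvgP.
apply: cvg_trans dk; apply: near_eq_cvg; near=> h.
by rewrite [h *: 1]mulr1 addr0 -rayE -(rayE 0) scale0r add0r.
Unshelve. all: by end_near. Qed.

(** * Local constancy of the function in the direction of the line *)

(** F is constant along w, so its increments in the direction u at x and at
x + r w agree, and so do the derivatives c f there. *)
Lemma locally_constant_along (R : realType) (V : normedModType R)
    (F f : V -> R) (c : R) (u w : V) (S : set V) (x : V) :
  c != 0 -> open S ->
  (forall y, S y -> is_derive y w F 0) ->
  (forall y, S y -> is_derive y u F (c * f y)) ->
  S x -> \forall r \near (0 : R), f (x + r *: w) = f x.
Proof.
move=> c0 oS dw du Sx.
have /nbhs_ballP[d /= d0 dS] : nbhs x S by exact: open_nbhs_nbhs.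
pose N : R := `|u| + `|w| + 1.
have N0 : 0 < N by rewrite ltr_wpDl ?addr_ge0.
(* A whole parallelogram around x lies in S, so the segments along w used
   below stay in S. *)
have inS (h r : R) : `|h| < d / N -> `|r| < d / N -> S (x + h *: u + r *: w).
  move=> hd rd; apply: dS; rewrite -ball_normE/= -addrA opprD addNKr normrN.
  rewrite (le_lt_trans (ler_normD _ _))// !normrZ.
  apply: (@le_lt_trans _ _ (d / N * (`|u| + `|w|))).
    by rewrite mulrDr lerD// ler_wpM2r// ltW.
  by rewrite mulrAC ltr_pdivrMr// ltr_pM2l// /N ltrDl.
have dN0 : 0 < d / N by rewrite divr_gt0.
near=> r.
have rd : `|r| < d / N by near: r; exact: (@nbhs0_lt R R).
have zd : `|0 : R| < d / N by rewrite normr0.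
have Fw h : `|h| < d / N -> F (x + h *: u + r *: w) = F (x + h *: u).
  move=> hd; have [s /andP[s0 s1]|s _] :=
      @MVT_line R V F (fun=> 0) (x + h *: u) w r.
    apply: dw; apply: inS => //; rewrite normrM (ger0_norm s0).
    by rewrite (le_lt_trans _ rd)// ler_piMr.
  by rewrite mulr0 => /eqP; rewrite subr_eq0 => /eqP.
have Sxr : S (x + r *: w) by have := inS _ _ zd rd; rewrite scale0r addr0.
have /is_derive_cvgP dFxr := du _ Sxr.
have /is_derive_cvgP dFx := du _ Sx.
apply: (mulfI c0); apply: (cvg_unique _ dFxr) => //.
apply: cvg_trans dFx; apply: near_eq_cvg; near=> h.
have hd : `|h| < d / N by near: h; exact: (@dnbhs0_lt R R).
congr (_ *: (_ - _)).
  by rewrite addrC -Fw// addrCA addrA.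
by have := Fw _ zd; rewrite scale0r addr0 => ->.
Unshelve. all: by end_near. Qed.

(** A sum of extended reals is finite only if both summands are, and a nonzero
factor cannot make an infinite ray integral finite. *)
Lemma vline_transform_eq0 (R : realType) (u v : R * R) (cu cv : R)
    (f : R * R -> R) (x : R * R) : cu != 0 -> cv != 0 ->
  vline_transform cu cv u v f x = 0%E ->
  [/\ ray_integral f u x \is a fin_num, ray_integral f v x \is a fin_num &
    cv * fine (ray_integral f v x) = - (cu * fine (ray_integral f u x))].
Proof.
move=> cu0 cv0 T0.
have finM (c : R) (A : \bar R) : c != 0 ->
    (c%:E * A)%E \is a fin_num -> A \is a fin_num.
  by move=> c0; case: A => //; rewrite mulr_infty; case: sgrP c0;
    rewrite ?eqxx ?mul1e ?mulN1e.
have : vline_transform cu cv u v f x \is a fin_num by rewrite T0.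
rewrite /vline_transform fin_numD.
move=> /andP[/(finM _ _ cv0) fv /(finM _ _ cu0) fu].
split=> //; apply/eqP; rewrite -addr_eq0 -eqe EFinD !EFinM !fineK//.
exact/eqP.
Qed.

Lemma vline_constant_along (R : realType) (u v : R * R) (cu cv : R)
    (f : R * R -> R) (S : set (R * R)) (x : R * R) :
  cu != 0 -> cv != 0 -> continuous f -> open S ->
  (forall y, S y -> vline_transform cu cv u v f y = 0%E) -> S x ->
  \forall r \near (0 : R), f (x + r *: (cu *: v + cv *: u)) = f x.
Proof.
move=> cu0 cv0 cf oS T0.
pose F y := cv * fine (ray_integral f v y).
have dv y : S y -> is_derive y v F (- cv * f y).
  move=> /T0/(vline_transform_eq0 cu0 cv0)[_ fv _].
  by rewrite mulNr -mulrN; exact: (is_deriveZ cv (is_derive_ray_integral cf fv)).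
have du y : S y -> is_derive y u F (cu * f y).
  (* Near y the function F is also - cu times the ray integral along u. *)
  move=> Sy; have [fu _ _] := vline_transform_eq0 cu0 cv0 (T0 _ Sy).
  apply: (@near_eq_is_derive _ _ _ (fun z => - cu * fine (ray_integral f u z))).
    near=> z; have Sz : S z by near: z; exact: open_nbhs_nbhs.
    have [_ _ XE] := vline_transform_eq0 cu0 cv0 (T0 _ Sz).
    by rewrite /F XE mulNr.
  rewrite -mulrNN; exact: (is_deriveZ (- cu) (is_derive_ray_integral cf fu)).
apply: (locally_constant_along cu0 oS _ du) => y Sy.
have nS : \forall z \near y, S z by exact: open_nbhs_nbhs.
have cM (c : R) : {for y, continuous (fun z => c * f z)}.
  by apply: cvgM; [exact: cvg_cst|exact: cf].
rewrite addrC (_ : 0 = cv * (cu * f y) + cu * (- cv * f y)); last first.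
  by rewrite mulNr mulrN mulrCA subrr.
apply: (@is_derive_lin_comb _ _ F (fun z => cu * f z) (fun z => - cv * f z)).
- by apply: filterS nS => z /du.
- by apply: filterS nS => z /dv.
- exact: cM.
- exact: cM.
Unshelve. all: by end_near. Qed.

(** * From local to global *)

(** The norm of r w is |r| times that of w, so on a line closeness of z to y
means that the parameter r is small. *)
Lemma near_line (R : realType) (V : normedModType R) (w y : V) (L P : set V) :
  w != 0 -> (forall z, L z -> exists r : R, z = y + r *: w) ->
  (\forall r \near (0 : R), P (y + r *: w)) -> \forall z \near y, L z -> P z.
Proof.
move=> w0 Ly /nbhs_ballP[e /= e0 eP].
have w_gt0 : 0 < `|w| by rewrite normr_gt0.
apply/nbhs_ballP; exists (e * `|w|); first by rewrite /= mulr_gt0.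
move=> z + /Ly[r zE]; rewrite {}zE -ball_normE/= opprD addNKr normrN normrZ.
rewrite ltr_pM2r// => re; apply: eP.
by rewrite -ball_normE/= sub0r normrN.
Qed.

Lemma alpha_line_direction (R : realType) (u v y z : R * R) (cu cv : R) L :
  line_parallel_to (alpha cu cv u v) L -> L y -> L z ->
  exists r : R, z = y + r *: (cu *: v + cv *: u).
Proof.
move=> [p ->] [s _ <-] [t _ <-]; exists ((t - s) / enorm (cu *: v + cv *: u)).
by rewrite -scalerA -addrA -scalerDl subrKC.
Qed.

Lemma connected_constant_on (T : topologicalType) (R : realType) (f : T -> R)
    (A : set T) : continuous f -> connected A ->
  (forall y, A y -> \forall z \near y, A z -> f z = f y) -> constant_on f A.
Proof.
move=> cf cA lf.
have [->|/set0P[x Ax]] := eqVneq A set0; first by exists 0.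
exists (f x); pose B := A `&` f @^-1` [set f x].
suff : B = A by move=> BA y; rewrite -{1}BA => -[].
apply: cA; first by exists x.
- exists [set y | \forall z \near y, A z -> f z = f x]^°.
    exact: open_interior.
  apply/seteqP; split=> [y [Ay fy]|y [Ay /interior_subset/nbhs_singleton fy]].
    split=> //; apply/nbhs_interior; rewrite -[f x]fy; exact: lf.
  by split; last exact: fy.
- exists (f @^-1` [set f x]) => //.
  by apply: preimage_closed => // *; exact: cf.
Qed.

(** A nonzero value of f at x would propagate along the whole line through x:
points carrying this value are never boundary points of S, so the propagation
cannot stop before it leaves every bounded set. *)
Lemma vline_zero_compact (R : realType) (u v : R * R) (cu cv : R)
    (f : R * R -> R) (S : set (R * R)) :
  cu != 0 -> cv != 0 -> cu *: v + cv *: u != 0 -> continuous f -> compact S ->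
  (forall y, S y -> vline_transform cu cv u v f y = 0%E) ->
  (forall y, boundary S y -> f y = 0) -> forall x, S x -> f x = 0.
Proof.
move=> cu0 cv0; set w := cu *: v + cv *: u => w0 cf cS T0 b0 x Sx.
apply/eqP/negP => /negP fx0.
pose B := [set t : R | S (x + t *: w) /\ f (x + t *: w) = f x].
have cline : continuous (fun t : R => x + t *: w).
  by move=> t; apply: cvgD; [exact: cvg_cst|apply: cvgZr_tmp; exact: cvg_id].
have BT : B = setT.
  have /connected_intervalP : is_interval [set: R] by [].
  apply.
  - by exists 0; rewrite /B/= scale0r addr0.
  - exists B; last by rewrite setTI.
    rewrite openE => t [St ft].
    have iS : S^° (x + t *: w).
      apply: contrapT => nS; move: fx0; rewrite -ft b0 ?eqxx//.
      by split => //; exact: subset_closure.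
    have T0' y : S^° y -> vline_transform cu cv u v f y = 0%E.
      by move=> /interior_subset/T0.
    have := vline_constant_along cu0 cv0 cf (open_interior S) T0' iS.
    rewrite -/w => loc.
    have st0 : s - t @[s --> t] --> (0 : R).
      by rewrite -(subrr t); apply: cvgB; [exact: cvg_id|exact: cvg_cst].
    have loct : \forall s \near t,
        f (x + t *: w + (s - t) *: w) = f (x + t *: w).
      exact: st0 loc.
    have St' : \forall s \near t, S (x + s *: w) by exact: cline iS.
    apply: filterS2 loct St' => s fs Ss; split=> //.
    by rewrite -ft -fs -addrA -scalerDl subrKC.
  - exists B; last by rewrite setTI.
    have -> : B =
      (fun t : R => x + t *: w) @^-1` (S `&` f @^-1` [set f x]) by [].
    apply: preimage_closed => [t _|]; first exact: cline.
    apply: closedI; first exact: compact_closed.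
    by apply: preimage_closed => // *; exact: cf.
have [M [_ SM]] := compact_bounded cS.
have w_gt0 : 0 < `|w| by rewrite normr_gt0.
have M1 : M < `|M| + 1 by rewrite (le_lt_trans (ler_norm M))// ltrDl.
pose t := (`|M| + 1 + `|x| + 1) / `|w|.
have [St _] : B t by rewrite BT.
have := SM _ M1 _ St; apply/negP; rewrite -ltNge/= [x + _]addrC.
apply: lt_le_trans (lerB_normD _ _).
rewrite normrZ ger0_norm ?divr_ge0 ?addr_ge0// divfK ?gt_eqF//.
by rewrite addrAC addrK ltrDl.
Qed.

Theorem theorem14 (R : realType) (u v : R * R) (cu cv : R) (f : R * R -> R)
    (hu : enorm u = 1) (hv : enorm v = 1) (huv : lin_indep u v)
    (hangle : 0 < angle u v < pi)
    (hcu : cu != 0) (hcv : 0 < cv)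
    (hf1 : L1_plane f) (hfc : continuous f) :
  (forall S : set (R * R), open S ->
     (forall x, S x -> vline_transform cu cv u v f x = 0%E) ->
     forall L : set (R * R), line_parallel_to (alpha cu cv u v) L ->
     L `&` S !=set0 ->
     forall x, (L `&` S) x -> constant_on f (connected_component (L `&` S) x))
  /\
  (forall S : set (R * R), compact S ->
     (forall x, S x -> vline_transform cu cv u v f x = 0%E) ->
     (forall x, boundary S x -> f x = 0) ->
     forall x, S x -> f x = 0).
Proof.
have cv0 : cv != 0 by rewrite gt_eqF.
have w0 : cu *: v + cv *: u != 0.
  apply/eqP; rewrite addrC => /huv[cv0' _].
  by move: cv0; rewrite cv0' eqxx.
split=> [S oS T0 L Lw _ x _|S cS T0 b0]; last exact: vline_zero_compact T0 b0.
apply: connected_constant_on => //; first exact: component_connected.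
move=> y /connected_component_sub[Ly Sy].
have := @near_line _ _ _ _ L [set z | f z = f y] w0
  (fun z => alpha_line_direction Lw Ly)
  (vline_constant_along hcu cv0 hfc oS T0 Sy).
apply: filterS => z fz /connected_component_sub[Lz _]; exact: fz.
Qed.
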